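(* Let $G$ be an $n$-vertex connected graph with independence number $i$. If $\alpha\in[0,1)$, then $\lambda_\alpha(G)\leqslant\lambda_\alpha(K_i^c\vee K_{n-i})$, with equality if and only if $G\cong K_i^c\vee K_{n-i}$.
   Context: For a graph $G$ with adjacency matrix $A(G)$ and diagonal degree matrix $D(G)$, and $\alpha\in[0,1]$, $A_\alpha(G)=\alpha D(G)+(1-\alpha)A(G)$ and $\lambda_\alpha(G)$ denotes its largest eigenvalue. The independence number is the maximum size of a set of pairwise non-adjacent vertices. $K_i^c$ is the empty graph on $i$ vertices, and $H_1\vee H_2$ (join) is obtained from disjoint $H_1,H_2$ by joining every vertex of $H_1$ to every vertex of $H_2$. *)

(* Defs.v *)
From HB Require Import structures.
From mathcomp Require Import all_boot all_order all_algebra.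
From mathcomp Require Import boolp classical_sets reals.
From mathcomp Require complex.

Set Implicit Arguments.
Unset Strict Implicit.
Unset Printing Implicit Defensive.

Import Order.TTheory GRing.Theory Num.Theory.

Record sgraph := SGraph {
  vertex :> finType;
  edge : rel vertex;
  edge_sym : symmetric edge;
  edge_irrefl : irreflexive edge }.

Section GraphNotions.
Variable G : sgraph.

Definition graph_connected : Prop :=
  (0 < #|G|)%N /\ forall x y : G, connect (@edge G) x y.

Definition independent (S : {set G}) : bool :=
  [forall x in S, forall y in S, ~~ edge x y].

Definition independence_number : nat :=
  \max_(S : {set G} | independent S) #|S|.

Definition degree (x : G) : nat := #|[set y | edge x y]|.

End GraphNotions.

Definition graph_iso (G H : sgraph) : Prop :=
  exists f : G -> H, bijective f /\ forall x y, edge (f x) (f y) = edge x y.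

Section EmptyGraph.
Variable k : nat.

Definition empty_rel (_ _ : 'I_k) : bool := false.

Lemma empty_rel_sym : symmetric empty_rel. Proof. by []. Qed.

Lemma empty_rel_irrefl : irreflexive empty_rel. Proof. by []. Qed.

Definition empty_graph : sgraph := SGraph empty_rel_sym empty_rel_irrefl.

End EmptyGraph.

Section CompleteGraph.
Variable k : nat.

Definition complete_rel (x y : 'I_k) : bool := x != y.

Lemma complete_rel_sym : symmetric complete_rel.
Proof. by move=> x y; rewrite /complete_rel eq_sym. Qed.

Lemma complete_rel_irrefl : irreflexive complete_rel.
Proof. by move=> x; rewrite /complete_rel eqxx. Qed.

Definition complete_graph : sgraph :=
  SGraph complete_rel_sym complete_rel_irrefl.

End CompleteGraph.

Section Join.
Variables H1 H2 : sgraph.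

Definition join_rel (x y : H1 + H2) : bool :=
  match x, y with
  | inl a, inl b => edge a b
  | inr a, inr b => edge a b
  | _, _ => true
  end.

Lemma join_rel_sym : symmetric join_rel.
Proof. by move=> [x|x] [y|y] //=; rewrite edge_sym. Qed.

Lemma join_rel_irrefl : irreflexive join_rel.
Proof. by move=> [x|x] /=; rewrite edge_irrefl. Qed.

Definition graph_join : sgraph := SGraph join_rel_sym join_rel_irrefl.

End Join.

Local Open Scope ring_scope.

Section Spectrum.
Variable R : realType.

(* Rows and columns are indexed through the enumeration of the vertices; the
   eigenvalues do not depend on it. *)
Definition adjacency_mx (G : sgraph) : 'M[R]_#|G| :=
  \matrix_(i, j) (edge (enum_val i) (enum_val j))%:R.

Definition degree_mx (G : sgraph) : 'M[R]_#|G| :=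
  diag_mx (\row_i (degree (enum_val i))%:R).

Definition Aalpha (alpha : R) (G : sgraph) : 'M[R]_#|G| :=
  alpha *: degree_mx G + (1 - alpha) *: adjacency_mx G.

(* The supremum is attained when M is symmetric and n > 0, see
   [largest_eigenvalueP] below. *)
Definition largest_eigenvalue n (M : 'M[R]_n) : R :=
  sup [set a : R | eigenvalue M a]%classic.

Definition lambda (alpha : R) (G : sgraph) : R :=
  largest_eigenvalue (Aalpha alpha G).

Lemma Aalpha_sym (alpha : R) (G : sgraph) :
  (Aalpha alpha G)^T = Aalpha alpha G.
Proof.
rewrite /Aalpha linearD !linearZ /= tr_diag_mx; congr (_ + _ *: _).
by apply/matrixP => i j; rewrite !mxE edge_sym.
Qed.

End Spectrum.

Section LargestEigenvalue.
Import complex.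
Variables (R : realType) (n : nat) (M : 'M[R]_n).

Let C : numClosedFieldType := R[i]%C.
Let toC : {rmorphism R -> C} := real_complex R.
Let MC : 'M[C]_n := map_mx toC M.

Let eigenvalueC (a : R) : eigenvalue M a = eigenvalue MC (toC a).
Proof. by rewrite !eigenvalue_root_char -map_char_poly fmorph_root. Qed.

Let eigenvalue_seq : {s : seq R | forall a, eigenvalue M a -> a \in s}.
Proof.
have [r Er] := closed_field_poly_normal (char_poly MC).
exists [seq complex.Re z | z <- r] => a; rewrite eigenvalueC.
rewrite eigenvalue_root_char Er (monicP (char_poly_monic _)) scale1r.
by rewrite root_prod_XsubC => ra; apply/mapP; exists (toC a).
Qed.

Lemma symmetric_eigenvalue : (0 < n)%N -> M^T = M -> exists a, eigenvalue M a.
Proof.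
move=> n_gt0 symM.
have /closed_rootP[z] : size (char_poly MC) != 1.
  by rewrite size_char_poly eqSS -lt0n.
rewrite -eigenvalue_root_char => eMz.
suff /complex_realP[a Ez] : z \is Num.real.
  by exists a; rewrite eigenvalueC; move: eMz; rewrite Ez.
have /eigenvalueP[v Ev v0] := eMz.
pose w : 'rV[C]_n := map_mx Num.conj v.
have conjMC : map_mx Num.conj MC = MC.
  apply/matrixP => j k; rewrite !mxE; apply/CrealP/complex_realP.
  by exists (M j k).
have Ew : w *m MC = z^* *: w by rewrite -map_mxZ -Ev map_mxM conjMC.
have symMC : MC^T = MC by apply/matrixP => j k; rewrite !mxE -[in LHS]symM mxE.
have : z *: (v *m w^T) = z^* *: (v *m w^T).
  by rewrite scalemxAl -Ev -mulmxA -{1}symMC -trmx_mul Ew linearZ -scalemxAr.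
move/eqP; rewrite -subr_eq0 -scalerBl scaler_eq0 subr_eq0 => /orP[/eqP Ez|].
  exact/CrealP.
move=> /eqP/matrixP/(_ 0 0); rewrite !mxE => /eqP.
rewrite psumr_eq0 => [|j _]; last by rewrite !mxE mul_conjC_ge0.
move=> /allP vw0; case/eqP: v0; apply/rowP => j; rewrite mxE.
have := vw0 j (mem_index_enum _); rewrite !mxE mul_conjC_eq0.
by move/eqP.
Qed.

Lemma largest_eigenvalueP : (0 < n)%N -> M^T = M ->
  eigenvalue M (largest_eigenvalue M) /\
  forall a, eigenvalue M a -> a <= largest_eigenvalue M.
Proof.
move=> n_gt0 symM.
suff [m em mP] : exists2 m, eigenvalue M m & forall a, eigenvalue M a -> a <= m.
  suff -> : largest_eigenvalue M = m by [].
  apply/eqP; rewrite eq_le; apply/andP; split.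
    by apply: ge_sup; [exists m | move=> a /mP].
  by apply: ub_le_sup; [exists m => a /mP | ].
have [a0 ea0] := symmetric_eigenvalue n_gt0 symM.
have [s sP] := eigenvalue_seq.
pose t := [seq a <- s | eigenvalue M a].
have tE a : (a \in t) = eigenvalue M a.
  by rewrite mem_filter andb_idr //; exact: sP.
have mem_big u : \big[Num.max/a0]_(a <- u) a \in a0 :: u.
  elim: u => [|a u IHu]; first by rewrite big_nil inE.
  rewrite big_cons; case: leP => _; last by rewrite !inE eqxx orbT.
  by move: IHu; rewrite !inE => /orP[->|->]; rewrite ?orbT.
exists (\big[Num.max/a0]_(a <- t) a).
  by have := mem_big t; rewrite inE => /orP[/eqP ->|]; rewrite ?tE.
by move=> a; rewrite -tE => ta; apply: (@le_bigmax_seq _ _ _ _ _ a _ id) => //.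
Qed.

End LargestEigenvalue.

(* Main.v *)
(** The join [H] has a positive eigenfunction [z], constant on both parts, for
    an eigenvalue [rho].  A maximum independent set of [G] identifies [G] with a
    spanning subgraph of [H], so [z], carried over to [G], is a positive
    supersolution: [A_alpha(G) z <= rho z] pointwise.  Pairing it with [|u|], for
    [u] an eigenfunction of [G], bounds the eigenvalue by [rho].  If the bound is
    attained then [|u|] is itself an eigenfunction, hence positive because [G] is
    connected, so [A_alpha(G) z = rho z] and no edge of [H] is missing in [G]. *)
Require Import Defs.
From mathcomp Require Import all_boot all_order all_algebra.
From mathcomp Require Import reals.
From mathcomp Require Import ring lra.

Set Implicit Arguments.
Unset Strict Implicit.
Unset Printing Implicit Defensive.

Import Order.TTheory GRing.Theory Num.Theory.
Local Open Scope ring_scope.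

(** * [A_alpha] acting on functions, and comparison with positive supersolutions *)

Section AalphaOperator.
Variables (R : realType) (alpha : R).

(* [A_alpha] as an operator on functions, with the degree term distributed over
   the neighbours. *)
Definition Aop (G : sgraph) (u : G -> R) (x : G) : R :=
  \sum_(y | edge x y) (alpha * u x + (1 - alpha) * u y).

Lemma eigenvalue_AalphaP (G : sgraph) (a : R) :
  eigenvalue (Aalpha alpha G) a <->
  exists2 u : G -> R, (exists x, u x != 0) & forall x, Aop u x = a * u x.
Proof.
have AalphaE (v : 'rV[R]_#|G|) (u : G -> R) j :
    (forall k, v 0 k = u (enum_val k)) ->
    (v *m Aalpha alpha G) 0 j = Aop u (enum_val j).
  (* Transposing the symmetric matrix turns the column sum of the row-vector product into a sum over
     the neighbours of vertex [j], as in [Aop]. *)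
  move=> uE; rewrite -[X in v *m X]Aalpha_sym mxE.
  rewrite /Aop big_split /= sumr_const.
  under eq_bigr do rewrite !mxE uE mulrDr.
  rewrite big_split /=; congr (_ + _).
    rewrite (bigD1 j) //= big1 ?addr0 => [|k /negPf kj].
      by rewrite eqxx mulr1n /degree cardsE -mulr_natr; ring.
    by rewrite eq_sym kj mulr0n !mulr0.
  rewrite [RHS]big_mkcond (reindex (@enum_val G G)) /=; last first.
    exact: onW_bij (@enum_val_bij G).
  apply: eq_bigr => k _; case: ifP => _.
    by rewrite mulr1 mulrC.
  by rewrite !mulr0.
split=> [/eigenvalueP[v Ev v0]|[u [x ux0] Eu]].
  have uE k : v 0 k = v 0 (enum_rank (enum_val k : G)) by rewrite enum_valK.
  exists (fun x => v 0 (enum_rank x)) => [|x].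
    have /rV0Pn[k vk0] := v0.
    by exists (enum_val k); rewrite enum_valK.
  by rewrite -[in LHS](enum_rankK x) -(AalphaE _ _ _ uE) Ev mxE.
apply/eigenvalueP; exists (\row_k u (enum_val k)).
  by apply/rowP => j; rewrite (AalphaE _ u) ?Eu ?mxE // => k; rewrite mxE.
by apply/rV0Pn; exists (enum_rank x); rewrite mxE enum_rankK.
Qed.

(** The degree part is symmetric pointwise; the adjacency part becomes so after exchanging the two
    sums, as [edge] is symmetric. *)
Lemma Aop_selfadjoint (G : sgraph) (u v : G -> R) :
  \sum_x u x * Aop v x = \sum_x v x * Aop u x.
Proof.
have AopE (f g : G -> R) : \sum_x f x * Aop g x =
    \sum_x \sum_(y | edge x y) alpha * (f x * g x)
    + \sum_x \sum_(y | edge x y) (1 - alpha) * (f x * g y).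
  rewrite -big_split; apply: eq_bigr => x _ /=.
  rewrite -big_split mulr_sumr; apply: eq_bigr => y _ /=; ring.
rewrite !AopE; congr (_ + _).
  by apply: eq_bigr => x _; apply: eq_bigr => y _; rewrite (mulrC (u x)).
rewrite (exchange_big_dep predT) //=.
apply: eq_bigr => x _; apply: eq_big => [y|y _]; first exact: edge_sym.
by rewrite (mulrC (u y)).
Qed.

Hypotheses (alpha_ge0 : 0 <= alpha) (alpha_lt1 : alpha < 1).

Let beta_gt0 : 0 < 1 - alpha. Proof. by rewrite subr_gt0. Qed.

Lemma normr_Aop (G : sgraph) (u : G -> R) x :
  `|Aop u x| <= Aop (fun y => `|u y|) x.
Proof.
apply: le_trans (ler_norm_sum _ _ _) _; apply: ler_sum => y _.
rewrite (le_trans (ler_normD _ _)) // !normrM.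
by rewrite (ger0_norm alpha_ge0) (gtr0_norm beta_gt0).
Qed.

(** At a zero of [u] the eigenvalue equation is a vanishing sum of nonnegative terms
    [(1 - alpha) * u y], so all neighbours are zeros too; by connectedness a single zero would make
    [u] vanish everywhere. *)
Lemma eigenfunction_gt0 (G : sgraph) (u : G -> R) (a : R) :
  (forall x y : G, connect (@edge G) x y) -> (forall x, 0 <= u x) ->
  (exists x, u x != 0) -> (forall x, Aop u x = a * u x) -> forall x, 0 < u x.
Proof.
move=> conG u_ge0 [x0 ux0] Eu x; rewrite lt_neqAle u_ge0 andbT eq_sym.
apply: contra ux0 => ux0.
suff cl : closed (@edge G) [pred y | u y == 0].
  by have := closed_connect cl (conG x x0); rewrite !inE ux0 => <-.
apply: intro_closed; first exact: sym_connect_sym (@edge_sym G).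
move=> y1 y2 /= e12; rewrite !inE => /eqP uy1.
have /eqP := Eu y1; rewrite uy1 mulr0 psumr_eq0 => [/allP/(_ y2)|y _]; last first.
  by rewrite uy1 mulr0 add0r mulr_ge0 // ltW.
rewrite mem_index_enum e12 uy1 mulr0 add0r mulf_eq0 (gt_eqF beta_gt0).
exact.
Qed.

Section Supersolution.
Variables (G : sgraph) (w : G -> R) (rho : R).
Hypotheses (w_gt0 : forall x, 0 < w x)
  (w_super : forall x, Aop w x <= rho * w x).

Lemma supersolution_ge (a : R) : eigenvalue (Aalpha alpha G) a -> a <= rho.
Proof.
move=> /eigenvalue_AalphaP[u [x0 ux0] Eu].
have nn x : 0 <= w x * `|u x| by rewrite mulr_ge0 // ltW.
have S_gt0 : 0 < \sum_x w x * `|u x|.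
  rewrite (bigD1 x0) //= ltr_wpDr ?sumr_ge0 //.
  by rewrite mulr_gt0 // normr_gt0.
rewrite -(ler_pM2r S_gt0) !mulr_sumr.
apply: (@le_trans _ _ (\sum_x w x * Aop (fun y => `|u y|) x)).
  apply: ler_sum => x _; rewrite mulrCA ler_pM2l //.
  apply: le_trans (normr_Aop _ _); rewrite Eu normrM.
  by rewrite ler_wpM2r // ler_norm.
rewrite Aop_selfadjoint; apply: ler_sum => x _.
by rewrite mulrC mulrA ler_wpM2r.
Qed.

Lemma supersolution_eq :
  (forall x y : G, connect (@edge G) x y) -> eigenvalue (Aalpha alpha G) rho ->
  forall x, Aop w x = rho * w x.
Proof.
move=> conG /eigenvalue_AalphaP[u [x0 ux0] Eu].
pose v x : R := `|u x|.
have v_sub x : rho * v x <= Aop v x.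
  rewrite /v; apply: le_trans (normr_Aop _ _); rewrite Eu normrM.
  by rewrite ler_wpM2r // ler_norm.
have d1_ge0 x : true -> 0 <= w x * (Aop v x - rho * v x).
  by move=> _; rewrite mulr_ge0 ?subr_ge0 // ltW.
have d2_ge0 x : true -> 0 <= v x * (rho * w x - Aop w x).
  by move=> _; rewrite mulr_ge0 ?subr_ge0 // normr_ge0.
(* [v] is a subsolution and [w] a supersolution for the same [rho]. Self-adjointness makes the two
   nonnegative weighted defects cancel, so each vanishes pointwise. *)
have : \sum_x w x * (Aop v x - rho * v x)
       + \sum_x v x * (rho * w x - Aop w x) = 0.
  under eq_bigr do rewrite mulrBr.
  under [X in _ + X]eq_bigr do rewrite mulrBr.
  rewrite !sumrB Aop_selfadjoint.
  have -> : \sum_x w x * (rho * v x) = \sum_x v x * (rho * w x).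
    by apply: eq_bigr => x _; ring.
  by ring.
move/eqP; rewrite paddr_eq0 ?sumr_ge0 // => /andP[/eqP d1 /eqP d2].
have Ev x : Aop v x = rho * v x.
  move/eqP: (psumr_eq0P d1_ge0 d1 (i := x) isT).
  by rewrite mulf_eq0 gt_eqF //= subr_eq0 => /eqP.
have v_gt0 : forall x, 0 < v x.
  apply: eigenfunction_gt0 Ev => // [x|]; first exact: normr_ge0.
  by exists x0; rewrite normr_eq0.
move=> x; move/eqP: (psumr_eq0P d2_ge0 d2 (i := x) isT).
by rewrite mulf_eq0 gt_eqF //= subr_eq0 => /eqP.
Qed.

End Supersolution.

Lemma eigenvalue_lambda (G : sgraph) :
  (0 < #|G|)%N -> eigenvalue (Aalpha alpha G) (lambda alpha G).
Proof. by move=> G0; have [] := largest_eigenvalueP G0 (Aalpha_sym alpha G). Qed.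

(** A positive eigenfunction is a supersolution, so [rho] bounds every eigenvalue, and [rho] is
    itself one. *)
Lemma lambda_positive_eigenfunction (G : sgraph) (w : G -> R) (rho : R) :
  (0 < #|G|)%N -> (forall x, 0 < w x) -> (forall x, Aop w x = rho * w x) ->
  lambda alpha G = rho.
Proof.
move=> G0 w0 Ew; apply/eqP; rewrite eq_le; apply/andP; split.
  apply: (@supersolution_ge _ w) => // [x|]; first by rewrite Ew.
  exact: eigenvalue_lambda.
have [_ -> //] := largest_eigenvalueP G0 (Aalpha_sym alpha G).
apply/eigenvalue_AalphaP; exists w => //.
by have /card_gt0P[x _] := G0; exists x; rewrite gt_eqF.
Qed.

End AalphaOperator.

Lemma Aop_iso (R : realType) (alpha : R) (G H : sgraph) (f : G -> H)
    (z : H -> R) (x : G) :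
  bijective f -> (forall x y, edge (f x) (f y) = edge x y) ->
  Aop alpha (z \o f) x = Aop alpha z (f x).
Proof.
move=> bij_f fE; rewrite /Aop (reindex f) /=; last exact: onW_bij.
by apply: eq_bigl => y; rewrite fE.
Qed.

(** * Effect of missing edges on a positive function *)

Section SpanningSubgraph.
Variables (R : realType) (alpha : R) (G H : sgraph) (f : G -> H).
Hypotheses (alpha_ge0 : 0 <= alpha) (alpha_lt1 : alpha < 1).
Hypotheses (bij_f : bijective f).
Hypothesis (f_edge : forall x y, edge x y -> edge (f x) (f y)).
Variable z : H -> R.
Hypothesis z_gt0 : forall p, 0 < z p.

Let term_gt0 p q : 0 < alpha * z p + (1 - alpha) * z q.
Proof. by rewrite ltr_wpDl ?mulr_gt0 ?mulr_ge0 ?subr_gt0 // ltW. Qed.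

Let Aop_split x : Aop alpha z (f x) = Aop alpha (z \o f) x
  + \sum_(y | edge (f x) (f y) && ~~ edge x y)
      (alpha * z (f x) + (1 - alpha) * z (f y)).
Proof.
rewrite /Aop (reindex f) /=; last exact: onW_bij.
rewrite (bigID (fun y => edge x y)) /=; congr (_ + _).
by apply: eq_bigl => y; case exy: (edge x y); rewrite ?andbF // f_edge.
Qed.

Lemma Aop_spanning_le x : Aop alpha (z \o f) x <= Aop alpha z (f x).
Proof. by rewrite Aop_split lerDl sumr_ge0 // => y _; exact: ltW. Qed.

(** The difference of the two sides is a sum of strictly positive terms over the edges missing at
    [x], so it vanishes only if there are none. *)
Lemma Aop_spanning_eq x y :
  Aop alpha (z \o f) x = Aop alpha z (f x) -> edge (f x) (f y) = edge x y.
Proof.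
move/eqP; rewrite Aop_split -[X in X == _]addr0 (can_eq (addKr _)) eq_sym.
move=> /eqP S0.
case exy: (edge x y); first exact: f_edge.
apply/negP => fxy.
have term_ge0 t : edge (f x) (f t) && ~~ edge x t ->
    0 <= alpha * z (f x) + (1 - alpha) * z (f t).
  by move=> _; exact: ltW.
have := psumr_eq0P term_ge0 S0 (i := y); rewrite fxy exy => /(_ isT) E.
by have := term_gt0 (f x) (f y); rewrite E ltxx.
Qed.

End SpanningSubgraph.

(** * The positive eigenfunction of the join *)

Lemma positive_eigenvector2 (R : rcfType) (s p q t : R) : 0 < p -> 0 < q ->
  exists a b rho, [/\ 0 < a, 0 < b, s * a + p * b = rho * a
                    & q * a + t * b = rho * b].
Proof.
move=> p0 q0; pose d := Num.sqrt ((t - s) ^+ 2 + 4 * (p * q)).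
have pq0 : 0 < p * q by rewrite mulr_gt0.
have dE : d ^+ 2 = (t - s) ^+ 2 + 4 * (p * q).
  by rewrite sqr_sqrtr // addr_ge0 ?sqr_ge0 // mulr_ge0 // ltW.
have d0 : 0 <= d by exact: sqrtr_ge0.
(* [rho] is the larger root of the characteristic polynomial, with discriminant [d ^+ 2]; the second
   coordinate is positive because [p * q > 0] forces [d > |t - s|]. *)
exists (2 * p), (t - s + d), ((s + t + d) / 2); split.
- by rewrite mulr_gt0.
- by nra.
- by field.
- have : 4 * (p * q) = d ^+ 2 - (t - s) ^+ 2 by rewrite dE; ring.
  by move=> E; lra.
Qed.

Lemma sum_const_others (R : pzRingType) k (j : 'I_k) (c : R) :
  \sum_(y < k | j != y) c = (k%:R - 1) * c.
Proof.
have : \sum_(y < k) c = c + \sum_(y < k | j != y) c.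
  rewrite (bigD1 j) //=; congr (_ + _); apply: eq_bigl => y.
  by rewrite eq_sym.
rewrite sumr_const card_ord mulrBl mul1r mulr_natl => ->.
by rewrite addrC addKr.
Qed.

Lemma join_positive_eigenfunction (R : realType) (alpha : R) (i k : nat) :
  alpha < 1 -> (0 < i)%N ->
  let H := graph_join (empty_graph i) (complete_graph k) in
  exists z : H -> R, exists rho : R,
    (forall p, 0 < z p) /\ (forall p, Aop alpha z p = rho * z p).
Proof.
move=> alpha1 i0 H.
pose z (a b : R) : H -> R := fun p => if p is inl _ then a else b.
have AopE a b p : Aop alpha (z a b) p = if p is inl _ then
    k%:R * (alpha * a + (1 - alpha) * b)
  else i%:R * (alpha * b + (1 - alpha) * a) + (k%:R - 1) * b.
  rewrite /Aop big_sumType; case: p => [u|v] /=.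
    by rewrite big_pred0_eq add0r sumr_const card_ord mulr_natl.
  rewrite sumr_const card_ord mulr_natl; congr (_ + _).
  by rewrite sum_const_others; congr (_ * _); ring.
(* With no clique vertex the off-diagonal entry [k%:R * (1 - alpha)] would be zero; the join is then
   edgeless and constants have eigenvalue 0. *)
case: k => [|k] in H z AopE *.
  exists (z 1 1), 0; split=> [[]|[u|[]//]] //=.
  by rewrite AopE !mul0r.
(* These are the entries of the quotient matrix of the two parts; inside the clique, degree and
   adjacency contributions add up to [k.+1%:R - 1]. *)
have [||a [b [rho [a0 b0 E1 E2]]]] := @positive_eigenvector2 R
    (k.+1%:R * alpha) (k.+1%:R * (1 - alpha)) (i%:R * (1 - alpha))
    (i%:R * alpha + (k.+1%:R - 1)).
  by rewrite mulr_gt0 ?ltr0n ?subr_gt0.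
  by rewrite mulr_gt0 ?ltr0n ?subr_gt0.
exists (z a b), rho; split=> [[]|p] //.
rewrite AopE; case: p => _ /=.
  by rewrite -E1; ring.
by rewrite -E2; ring.
Qed.

(** * Embedding a graph into the join through a maximum independent set *)

Lemma independence_number_witness (G : sgraph) :
  exists2 S : {set G}, independent S & #|S| = independence_number G.
Proof.
have ind0 : independent (set0 : {set G}).
  by apply/forall_inP => x; rewrite inE.
have [|S indS E] := @eq_bigmax_cond _ (@independent G) (fun S : {set G} => #|S|).
  by apply/card_gt0P; exists set0.
by exists S.
Qed.

Lemma independence_number_gt0 (G : sgraph) :
  (0 < #|G|)%N -> (0 < independence_number G)%N.
Proof.
move=> /card_gt0P[x _]; rewrite -(cards1 x).
apply: (@leq_bigmax_cond _ _ (fun S : {set G} => #|S|)).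
apply/forall_inP => y /set1P ->; apply/forall_inP => _ /set1P ->.
by rewrite edge_irrefl.
Qed.

(** The inverse map is built first: it enumerates a maximum independent set on one part and its
    complement on the other. Distinct non-adjacent vertices of the join both lie in the empty part,
    hence come from the independent set. *)
Lemma spanning_subgraph_of_join (G : sgraph) :
  let i := independence_number G in
  exists f : G -> graph_join (empty_graph i) (complete_graph (#|G| - i)),
    bijective f /\ forall x y, edge x y -> edge (f x) (f y).
Proof.
move=> i; have [S indS cardS] := independence_number_witness G.
have cardC : (#|G| - i)%N = #|~: S| by rewrite cardsCs setCK cardS.
pose H := graph_join (empty_graph i) (complete_graph (#|G| - i)).
pose g (p : H) : G := match p with
  | inl j => enum_val (cast_ord (esym cardS) j)
  | inr j => enum_val (cast_ord cardC j)
  end.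
have gS p : (g p \in S) = if p is inl _ then true else false.
  case: p => j /=; first exact: enum_valP.
  by apply/negbTE; have := enum_valP (cast_ord cardC j); rewrite inE.
have inj_g : injective g.
  move=> p q E; have := gS p; rewrite E gS.
  by case: p q E => [j|j] [l|l] //= /enum_val_inj/cast_ord_inj ->.
have [|f gK fK] := inj_card_bij inj_g.
  by rewrite card_sum !card_ord cardC /i -cardS cardsC.
exists f; split; first by exists g.
move=> x y; rewrite -{1}(fK x) -{1}(fK y).
case: (f x) (f y) => [j|j] [l|l] //= exy.
  have jS := gS (inl j); have lS := gS (inl l).
  by have := forall_inP (forall_inP indS _ jS) _ lS; rewrite /= exy.
by apply: contraL exy => /eqP ->; rewrite edge_irrefl.
Qed.

Theorem theorem1p6 (R : realType) (n i : nat) (alpha : R) (G : sgraph)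
  (G_order : #|G| = n)
  (G_connected : graph_connected G)
  (G_independence : independence_number G = i)
  (alpha_ge0 : 0 <= alpha) (alpha_lt1 : alpha < 1) :
  let H := graph_join (empty_graph i) (complete_graph (n - i)) in
  lambda alpha G <= lambda alpha H /\
  (lambda alpha G = lambda alpha H <-> graph_iso G H).
Proof.
move=> H; have [G_gt0 conG] := G_connected.
have i_gt0 : (0 < i)%N by rewrite -G_independence independence_number_gt0.
have [f [bij_f f_edge]] : exists f : G -> H,
    bijective f /\ forall x y, edge x y -> edge (f x) (f y).
  by rewrite /H -G_order -G_independence; exact: spanning_subgraph_of_join.
have [z [rho [z_gt0 Ez]]] :=
  join_positive_eigenfunction (n - i) alpha_lt1 i_gt0.
have H_gt0 : (0 < #|H|)%N by rewrite -(bij_eq_card bij_f).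
have rhoE : lambda alpha H = rho.
  exact: (@lambda_positive_eigenfunction _ _ alpha_ge0 alpha_lt1 H z).
have zf_gt0 x : 0 < (z \o f) x by exact: z_gt0.
have zf_super x : Aop alpha (z \o f) x <= rho * (z \o f) x.
  by rewrite /= -Ez; exact: Aop_spanning_le.
have eigG := eigenvalue_lambda alpha G_gt0.
rewrite rhoE; split; first exact: supersolution_ge zf_super _ eigG.
split=> [E|[g [bij_g g_edge]]].
  (* The embedding itself is the isomorphism: equality of the eigenvalues makes [z \o f] an exact
     eigenfunction, so [f] also reflects edges. *)
  exists f; split=> // x y.
  apply: (@Aop_spanning_eq _ alpha _ _ _ _ _ _ _ z) => //.
  rewrite Ez; apply: (supersolution_eq _ _ zf_gt0 zf_super) => //.
  by rewrite -E.
(* Conversely, [z] pulls back along the isomorphism to a positive eigenfunction of [G] for [rho]. *)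
apply: (@lambda_positive_eigenfunction _ _ _ _ G (z \o g)) => // x.
  exact: z_gt0.
by rewrite Aop_iso // Ez.
Qed.
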